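(* Suppose $\Theta$ is a compact Hausdorff space and that $\theta\mapsto r(\theta,\delta)$ is continuous on $\Theta$ for every $\delta\in\mathcal D$. For $\delta_0\in\mathcal D$, the following statements are equivalent: (1) $\delta_0$ is extended admissible among $\mathcal D_{0,FC}$. (2) $\delta_0$ is extended Bayes among $\mathcal D_{0,FC}$. (3) $\delta_0$ is Bayes among $\mathcal D_{0,FC}$. If moreover condition (LC) holds, i.e. $\mathbb A$ is a vector space over $\mathbb R$ and $a\mapsto\ell(\theta,a)$ is convex for every $\theta\in\Theta$, then the equivalence extends to the three statements obtained from (1)-(3) by replacing $\mathcal D_{0,FC}$ with $\mathcal D_0$.
   Context: Statistical decision problem: a nonempty parameter space $\Theta$ (a topological space with its Borel $\sigma$-algebra); a measurable space $\mathbb A$ of actions; a loss $\ell:\Theta\times\mathbb A\to[0,\infty)$, measurable in the action; a measurable sample space $X$; probability measures $(P_\theta)_{\theta\in\Theta}$ on $X$. A (randomized) decision procedure is a map $\delta$ from $X$ to the probability measures on $\mathbb A$, with $\delta(x,A):=(\delta(x))(A)$, such that $x\mapsto\int_{\mathbb A}\ell(\theta,a)\,\delta(x,da)$ is measurable for every $\theta$. Its risk is $r(\theta,\delta)=\int_X\big[\int_{\mathbb A}\ell(\theta,a)\,\delta(x,da)\big]P_\theta(dx)$. $\mathcal D$ is the set of decision procedures with $r(\theta,\delta)<\infty$ for all $\theta$. Convex combinations are pointwise: $(\sum_ip_i\delta_i)(x)=\sum_ip_i\delta_i(x)$. $\mathcal D_0\subseteq\mathcal D$ is the set of nonrandomized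 procedures: for every $x$ there is $d(x)\in\mathbb A$ with $\delta(x,A)=1$ iff $d(x)\in A$, for all measurable $A$. $\mathcal D_{0,FC}$ is the set of all finite convex combinations of elements of $\mathcal D_0$. When (LC) is assumed, the usual mild measurability is also assumed: whenever $\delta=\sum_ip_i\delta_i\in\mathcal D_{0,FC}$ with $\delta_i$ given by $d_i$, the map $x\mapsto\ell(\theta,\sum_ip_id_i(x))$ is measurable for all $\theta$ (so the mean-action procedure is a nonrandomized decision procedure). For $\epsilon\ge0$ and $\delta,\delta'\in\mathcal D$, $\delta$ is $\epsilon$-dominated by $\delta'$ if $r(\theta,\delta')\le r(\theta,\delta)-\epsilon$ for all $\theta\in\Theta$ and $r(\theta,\delta')\ne r(\theta,\delta)$ for some $\theta$. For $\mathcal C\subseteq\mathcal D$, $\delta$ is $\epsilon$-admissible among $\mathcal C$ if it is not $\epsilon$-dominated by any $\delta'\in\mathcal C$, and extended admissible among $\mathcal C$ if it is $\epsilon$-admissible among $\mathcal C$ for all real $\epsilon>0$. A prior is a probability measure $\pi$ on the Borel sets of $\Theta$; $r(\pi,\delta)=\int_\Theta r(\theta,\delta)\,\pi(d\theta)$. $\delta$ is $\epsilon$-Bayes under $\pi$ among $\mathcal C$ if $r(\pi,\delta)<\infty$ and $r(\pi,\delta)\le r(\pi,\delta')+\epsilon$ for all $\delta'\in\mathcal C$. $\delta$ is Bayes among $\mathcal C$ if it is $0$-Bayes under some prior $\pi$ among $\mathcal C$. $\delta$ is extended Bayes among $\mathcal C$ if for every real $\epsilon>0$ there is a prior $\pi$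 such that $\delta$ is $\epsilon$-Bayes under $\pi$ among $\mathcal C$. *)

(* Defs.v *)
From HB Require Import structures.
From mathcomp Require Import all_boot all_order all_algebra.
From mathcomp Require Import all_classical all_reals all_analysis.
From mathcomp Require Import measurable_realfun.

Set Implicit Arguments.
Unset Strict Implicit.
Unset Printing Implicit Defensive.

Import Order.TTheory GRing.Theory Num.Theory numFieldNormedType.Exports.
Local Open Scope classical_set_scope.
Local Open Scope ring_scope.
Local Open Scope ereal_scope.

(* The real vector space carried by T, for a vector-space structure vs on T;
   this lets one put such a structure on the carrier of a measurableType. *)
Definition lmod_of (R : realType) (T : Type) (vs : GRing.Lmodule R T) :
  lmodType R := GRing.Lmodule.Pack vs.

(* For Theta pointed, i.e. nonempty: the measurable sets of this type are the
   Borel sets of Theta. *)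
Definition prior (R : realType) (Theta : ptopologicalType) : Type :=
  probability (g_sigma_algebraType (@open Theta)) R.

Section DecisionProblem.
Context {R : realType} {dX dA : measure_display}.
Context {X : measurableType dX} {A : measurableType dA}.
Context {Theta : ptopologicalType}.
Variables (loss : Theta -> A -> R) (P : Theta -> probability X R).

Definition expected_loss (theta : Theta) (m : probability A R) : \bar R :=
  \int[m]_a (loss theta a)%:E.

(* Measurability of x |-> delta x B is deliberately not required. *)
Definition decision_procedure (delta : X -> probability A R) : Prop :=
  forall theta, measurable_fun [set: X] (fun x => expected_loss theta (delta x)).

Definition risk (theta : Theta) (delta : X -> probability A R) : \bar R :=
  \int[P theta]_x expected_loss theta (delta x).

Definition procD : set (X -> probability A R) :=
  [set delta | decision_procedure delta /\ forall theta, risk theta delta < +oo].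

Definition concentrated_at (m : probability A R) (a : A) : Prop :=
  forall B, measurable B -> (m B = 1 <-> B a).

Definition procD0 : set (X -> probability A R) :=
  [set delta | procD delta /\ forall x, exists a, concentrated_at (delta x) a].

Definition convex_weights (n : nat) (p : 'I_n -> R) : Prop :=
  (forall i, (0 <= p i)%R) /\ (\sum_(i < n) p i = 1)%R.

(* Elements of [probability A R] are functions on all subsets of A, so equality
   of measures is equality on measurable sets. *)
Definition is_combination (n : nat) (p : 'I_n -> R)
    (deltas : 'I_n -> X -> probability A R) (delta : X -> probability A R) :=
  forall x B, measurable B -> delta x B = \sum_(i < n) (p i)%:E * deltas i x B.

Definition procD0FC : set (X -> probability A R) :=
  [set delta | exists n (p : 'I_n -> R) (deltas : 'I_n -> X -> probability A R),
    [/\ convex_weights p, forall i, procD0 (deltas i)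
      & is_combination p deltas delta]].

Definition dominated (eps : R) (delta delta' : X -> probability A R) : Prop :=
  (forall theta, risk theta delta' <= risk theta delta - eps%:E) /\
  (exists theta, risk theta delta' <> risk theta delta).

Definition admissible (eps : R) (C : set (X -> probability A R))
    (delta : X -> probability A R) : Prop :=
  ~ exists delta', C delta' /\ dominated eps delta delta'.

Definition extended_admissible (C : set (X -> probability A R))
    (delta : X -> probability A R) : Prop :=
  forall eps : R, (0 < eps)%R -> admissible eps C delta.

Definition bayes_risk (pi : prior R Theta) (delta : X -> probability A R) :
    \bar R :=
  \int[pi]_theta risk theta delta.

Definition eps_bayes (eps : R) (pi : prior R Theta)
    (C : set (X -> probability A R)) (delta : X -> probability A R) : Prop :=
  bayes_risk pi delta < +oo /\
  forall delta', C delta' -> bayes_risk pi delta <= bayes_risk pi delta' + eps%:E.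

Definition bayes (C : set (X -> probability A R))
    (delta : X -> probability A R) : Prop :=
  exists pi : prior R Theta, eps_bayes 0 pi C delta.

Definition extended_bayes (C : set (X -> probability A R))
    (delta : X -> probability A R) : Prop :=
  forall eps : R, (0 < eps)%R ->
    exists pi : prior R Theta, eps_bayes eps pi C delta.

Definition convex_loss (vs : GRing.Lmodule R A) : Prop :=
  forall theta, @convex_function R (lmod_of vs) [set: A] (loss theta).

Definition mean_action (vs : GRing.Lmodule R A) (n : nat) (p : 'I_n -> R)
    (a : 'I_n -> A) : A :=
  (\sum_(i < n) p i *: (a i : lmod_of vs))%R.

Definition mean_action_measurable (vs : GRing.Lmodule R A) : Prop :=
  forall n (p : 'I_n -> R) (deltas : 'I_n -> X -> probability A R)
    (d : 'I_n -> X -> A),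
  convex_weights p -> (forall i, procD0 (deltas i)) ->
  (forall i x, concentrated_at (deltas i x) (d i x)) ->
  forall theta,
    measurable_fun [set: X]
      (fun x => loss theta (mean_action vs p (fun i => d i x))).

End DecisionProblem.

(* Main.v *)
(* Only (1) => (3) is hard.  By Hahn-Banach, extended admissibility yields a
   positive normalized linear functional [L] on the bounded functions on [Theta]
   that is nonnegative on all the differences [r(., d) - r(., delta0)].  Then
   [A |-> L \1_A] is a finitely additive probability; approximating from inside
   by closed sets and then from outside by open sets turns it into a Borel
   probability [pi] with [pi U <= L \1_U] for [U] open, which is enough for the
   integral of every continuous function against [pi] to equal its [L]-value.
   Under (LC), Jensen's inequality shows that a finite mixture of nonrandomized
   procedures is improved by its mean-action procedure. *)

Require Import Defs.
From HB Require Import structures.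
From mathcomp Require Import all_boot all_order all_algebra.
From mathcomp Require Import all_classical all_reals all_analysis.
From mathcomp Require Import measurable_realfun.
From mathcomp Require Import lra.

Set Implicit Arguments.
Unset Strict Implicit.
Unset Printing Implicit Defensive.

Import Order.TTheory GRing.Theory Num.Theory numFieldNormedType.Exports.
Local Open Scope classical_set_scope.
Local Open Scope ring_scope.

(** * Hahn-Banach *)

Section HahnBanach.
Context {R : realType} {V : lmodType R}.
Implicit Types (p q s : V -> R) (u v w : V) (K : set V).

Definition sublinear p :=
  (forall u v, p (u + v) <= p u + p v) /\
  (forall (t : R) v, 0 <= t -> p (t *: v) <= t * p v).

Lemma sublinear0 p : sublinear p -> p 0 = 0.
Proof.
move=> [pD pZ]; have := pD 0 0; have := pZ 0 0 (lexx 0).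
by rewrite scale0r mul0r addr0; lra.
Qed.

Lemma sublinearZ p (t : R) v : sublinear p -> 0 <= t -> p (t *: v) = t * p v.
Proof.
move=> sp; have [_ pZ] := sp.
rewrite le_eqVlt => /predU1P[<-|t0].
  by rewrite scale0r mul0r; exact: sublinear0.
apply/eqP; rewrite eq_le pZ ?(ltW t0)//=.
have := pZ t^-1 (t *: v); rewrite scalerA mulVf ?gt_eqF// scale1r invr_ge0.
by move=> /(_ (ltW t0)); rewrite mulrC ler_pdivlMr// mulrC.
Qed.

Lemma sublinearN p v : sublinear p -> - p (- v) <= p v.
Proof. by move=> sp; have := sp.1 v (- v); rewrite subrr sublinear0//; lra. Qed.

Lemma ge_inf_image (I : Type) (D : set I) (F : I -> R) (m : R) i :
  (forall j, D j -> m <= F j) -> D i -> inf (F @` D) <= F i.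
Proof.
move=> mF Di; apply: ge_inf; last by exists i.
by exists m => _ [j Dj <-]; exact: mF.
Qed.

Lemma lb_le_inf_image (I : Type) (D : set I) (F : I -> R) (m : R) :
  D !=set0 -> (forall j, D j -> m <= F j) -> m <= inf (F @` D).
Proof.
move=> [i Di] mF; apply: lb_le_inf; first by exists (F i), i.
by move=> _ [j Dj <-]; exact: mF.
Qed.

(** The witness [k] may depend on both indices and both vectors, so in the subadditivity proof the
    two infima can be bounded one at a time; the lower bound [m] keeps every infimum a genuine one.
    It serves for chains, for the ray t >= 0 and for cones. *)
Lemma sublinear_inf (I : Type) (D : set I) (F : I -> V -> R) (m : V -> R) :
  D !=set0 -> (forall i v, D i -> m v <= F i v) ->
  (forall i j u v, D i -> D j -> exists2 k, D k & F k (u + v) <= F i u + F j v) ->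
  (forall i (t : R) v, D i -> 0 <= t ->
     exists2 k, D k & F k (t *: v) <= t * F i v) ->
  sublinear (fun v => inf [set F i v | i in D]).
Proof.
move=> D0 mF FD FZ; split=> [u v|t v t0].
  rewrite -lerBlDr; apply: lb_le_inf_image => // i Di.
  rewrite lerBlDr -lerBlDl; apply: lb_le_inf_image => // j Dj.
  have [k Dk Fk] := FD i j u v Di Dj.
  rewrite lerBlDl; apply: le_trans Fk.
  by apply: ge_inf_image Dk => l; exact: mF.
move: (t0); rewrite le_eqVlt => /predU1P[<-|tp].
  have [i Di] := D0; have [k Dk] := FZ i 0 v Di (lexx 0).
  rewrite !mul0r; apply: le_trans.
  by apply: (@ge_inf_image _ _ (fun i => F i _)) Dk => l; exact: mF.
rewrite mulrC -ler_pdivrMr//; apply: lb_le_inf_image => // i Di.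
have [k Dk Fk] := FZ i t v Di t0.
rewrite ler_pdivrMr// mulrC; apply: le_trans Fk.
by apply: (@ge_inf_image _ _ (fun i => F i _)) Dk => l; exact: mF.
Qed.

(** Zorn's lemma on the sublinear functionals below [q]: a nonempty chain is bounded by its
    pointwise infimum, which is finite because each member s satisfies - q (- v) <= - s (- v) <= s
    v. *)
Lemma minimal_sublinear q : sublinear q -> exists p,
  [/\ sublinear p, forall v, p v <= q v &
      forall p', sublinear p' -> (forall v, p' v <= p v) -> forall v, p v <= p' v].
Proof.
move=> sq.
pose T := {p : V -> R | sublinear p /\ forall v, p v <= q v}.
(* The order is reversed, so that a maximal element for [below] is a minimal functional. *)
pose below (p p' : T) := `[< forall v, sval p' v <= sval p v >].
pose t0 : T := exist _ q (conj sq (fun v => lexx (q v))).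
have [||A Atot|[p [sp pq]] pmin] := @ZL_preorder T t0 below.
- by move=> t; apply/asboolP.
- move=> r s t /asboolP rs /asboolP st; apply/asboolP => v.
  exact: le_trans (st v) (rs v).
- have [->|/set0P A0] := eqVneq A set0; first by exists t0.
  have low (s : T) v : A s -> - q (- v) <= sval s v.
    move=> _; have [ss sq'] := svalP s.
    by apply: le_trans (sublinearN v ss); rewrite lerN2.
  have infE (s : T) v : A s -> inf [set sval s v | s in A] <= sval s v.
    by move=> As; apply: ge_inf_image As => j; exact: low.
  have si : sublinear (fun v => inf [set sval s v | s in A]).
    apply: (@sublinear_inf T A (fun s : T => sval s) (fun v => - q (- v))) => //.
      move=> i j u v Ai Aj; have [[iD _] _] := svalP i.
      have [[jD _] _] := svalP j.
      case: (Atot i j Ai Aj) => /asboolP ij.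
        by exists j => //; apply: le_trans (jD _ _) _; rewrite lerD2r.
      by exists i => //; apply: le_trans (iD _ _) _; rewrite lerD2l.
    by move=> i t v Ai t0'; exists i => //; have [[_ ->]] := svalP i.
  have iq v : inf [set sval s v | s in A] <= q v.
    have [s As] := A0; apply: le_trans (infE s v As) _.
    by have [_] := svalP s; exact.
  exists (exist _ (fun v => inf [set sval s v | s in A]) (conj si iq) : T) => s As.
  by apply/asboolP => v /=; exact: infE.
- exists p; split=> // p' sp' p'p v.
  have p'q u : p' u <= q u := le_trans (p'p u) (pq u).
  have /= := pmin (exist _ p' (conj sp' p'q) : T).
  by move=> /(_ (asboolT p'p))/asboolP/(_ v).
Qed.

(* A minimal sublinear functional is linear: minimality forces [p] below the
   functional [inf_(t >= 0) p (h + t g) - t p g]; evaluate it at [h = - g]. *)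
Lemma hahn_banach q : sublinear q ->
  exists2 f : V -> R, linear_for *%R f & forall v, f v <= q v.
Proof.
move=> /minimal_sublinear[p [sp pq pmin]]; exists p => //.
have p0 := sublinear0 sp.
have pN g : p (- g) = - p g.
  pose F (t : R) h := p (h + t *: g) - t * p g.
  pose D := [set t : R | 0 <= t].
  have D0 : D 0 by rewrite /D /=.
  have low t h : D t -> - p (- h) <= F t h.
    move=> t0; rewrite /F -(sublinearZ g sp t0).
    have := sp.1 (h + t *: g) (- h); rewrite addrC addKr; lra.
  have sF : sublinear (fun h => inf [set F t h | t in D]).
    apply: (@sublinear_inf _ D F (fun h => - p (- h))) => //; first by exists 0.
      move=> s t u v s0 t0; exists (s + t); first exact: addr_ge0.
      have := sp.1 (u + s *: g) (v + t *: g).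
      by rewrite /F addrACA -scalerDl; lra.
    move=> s t v s0 t0; exists (t * s); first exact: mulr_ge0.
    by rewrite /F -scalerA -scalerDr sublinearZ//; lra.
  have Fp h : inf [set F t h | t in D] <= p h.
    apply: le_trans (@ge_inf_image _ _ (fun t => F t h) _ 0 _ D0) _.
      by move=> t; exact: low.
    by rewrite /F scale0r mul0r addr0 subr0.
  (* The index t = 1 gives p (- g) <= p 0 - p g = - p g; [sublinearN] gives the converse. *)
  have := pmin _ sF Fp (- g); have D1 : D 1 by rewrite /D /=.
  move=> /le_trans/(_ (@ge_inf_image _ _ (fun t => F t (- g)) _ 1 (fun t => @low t (- g)) D1)).
  have := sublinearN g sp.
  by rewrite /F scale1r addNr p0; lra.
have pD u v : p (u + v) = p u + p v.
  apply/eqP; rewrite eq_le sp.1 /=.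
  by have := sp.1 (- u) (- v); rewrite -opprD !pN; lra.
have pZ (t : R) v : p (t *: v) = t * p v.
  have [t0|t0] := leP 0 t; first exact: sublinearZ.
  have := sublinearZ v sp (ltW (_ : 0 < - t)); rewrite oppr_gt0 => /(_ t0).
  by rewrite scaleNr pN; lra.
by move=> t u v; rewrite pD pZ.
Qed.

(* A Mazur-Orlicz theorem: apply [hahn_banach] to [inf_(k in K) q (v + k)]. *)
Lemma hahn_banach_cone q K : sublinear q ->
  K 0 -> (forall u v, K u -> K v -> K (u + v)) ->
  (forall (t : R) v, 0 <= t -> K v -> K (t *: v)) ->
  (forall k, K k -> 0 <= q k) ->
  exists f : V -> R, [/\ linear_for *%R f, forall v, f v <= q v &
    forall k, K k -> 0 <= f k].
Proof.
move=> sq K0 KD KZ qK; pose F k v := q (v + k).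
have low k v : K k -> - q (- v) <= F k v.
  move=> Kk; have := sq.1 (v + k) (- v); have := qK _ Kk.
  by rewrite /F addrC addKr; lra.
have sF : sublinear (fun v => inf [set F k v | k in K]).
  apply: (@sublinear_inf _ K F (fun v => - q (- v))) => //; first by exists 0.
    move=> k l u v Kk Kl; exists (k + l); first exact: KD.
    by rewrite /F addrACA; exact: sq.1.
  move=> k t v Kk t0; exists (t *: k); first exact: KZ.
  by rewrite /F -scalerDr; exact: sq.2.
have [f flin fF] := hahn_banach sF.
have fle k v : K k -> f v <= F k v.
  move=> Kk; apply: le_trans (fF v) _; apply: (@ge_inf_image _ _ (fun l => F l v)) Kk.
  by move=> l; exact: low.
exists f; split=> // [v|k Kk].
  by have := fle 0 v K0; rewrite /F addr0.
have f0 : f 0 = 0 by have := flin 1 0 0; rewrite scale1r addr0; lra.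
(* Evaluating f <= q (. + k) at - k gives f (- k) <= q 0 = 0. *)
have := flin (-1) k 0; rewrite addr0 scaleN1r f0.
by have := fle k (- k) Kk; rewrite /F addNr sublinear0//; lra.
Qed.

End HahnBanach.

(** * Finitely additive means *)

Section BoundedFunctions.
Context {R : realType} {T : Type}.
Implicit Types f g : T -> R.

Definition bounded_function f := exists M, forall x, `|f x| <= M.

Definition bfun : {pred T -> R} := fun f => `[< bounded_function f >].

Lemma bfun_submod_closed : submod_closed bfun.
Proof.
split=> [|a f g /asboolP[M fM] /asboolP[N gN]]; apply/asboolP.
  by exists 0 => x; rewrite /= normr0.
exists (`|a| * M + N) => x; apply: (le_trans (ler_normD _ _)).
by rewrite lerD// normrM ler_wpM2l.
Qed.

HB.instance Definition _ := GRing.isSubmodClosed.Build R (T -> R) bfun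
  bfun_submod_closed.

(** Hahn-Banach needs a vector space on which the supremum is a finite sublinear functional. *)
Record bfun_type := BFun { bfun_val :> T -> R; _ : bfun_val \in bfun }.
HB.instance Definition _ := [isSub for bfun_val].
HB.instance Definition _ := [Choice of bfun_type by <:].
HB.instance Definition _ := [SubChoice_isSubLmodule of bfun_type by <:].

End BoundedFunctions.

Section Mean.
Context {R : realType} {T : Type}.
Implicit Types f g : T -> R.

Lemma bounded_functionP f : bounded_function f <-> f \in bfun.
Proof. by split=> [?|/asboolP]; [exact/asboolP|]. Qed.

Lemma bounded_function_lin (a : R) f g : bounded_function f ->
  bounded_function g -> bounded_function (a *: f + g).
Proof.
move=> /bounded_functionP bf /bounded_functionP bg.
by apply/bounded_functionP; exact: bfun_submod_closed.2.
Qed.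

Lemma bounded_function_cst (c : R) : bounded_function (cst c : T -> R).
Proof. by exists `|c|. Qed.

Lemma bounded_indic (A : set T) : bounded_function (\1_A : T -> R).
Proof. by exists 1 => x; rewrite indicE; case: (x \in A); rewrite ?normr1 ?normr0. Qed.

(* [L] is integration against a finitely additive probability. *)
Definition mean (L : (T -> R) -> R) := [/\
  forall (a : R) f g, bounded_function f -> bounded_function g ->
    L (a *: f + g) = a * L f + L g,
  forall f, bounded_function f -> (forall x, 0 <= f x) -> 0 <= L f &
  L (cst 1) = 1].

(** A linear functional below the supremum is automatically a mean: evaluating it at - f for f >= 0
    gives positivity, and at 1 and - 1 gives normalization. *)
Let sup_bfun (f : @bfun_type R T) : R := sup [set f x | x in [set: T]].

Let sup_bfun_ub (f : @bfun_type R T) (x : T) : f x <= sup_bfun f.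
Proof.
apply: ub_le_sup; last by exists x.
have /bounded_functionP[M fM] := valP f.
by exists M => _ [y _ <-]; exact: le_trans (ler_norm _) (fM y).
Qed.

Let sup_bfun_le (f : @bfun_type R T) (M : R) : inhabited T ->
  (forall x, f x <= M) -> sup_bfun f <= M.
Proof.
move=> [x0] fM; apply: ge_sup; first by exists (f x0), x0.
by move=> _ [y _ <-].
Qed.

(** The condition on [e] says that suprema are nonnegative on [K], which is what [hahn_banach_cone]
    requires of the dominating functional. *)
Lemma mean_cone (K : set (T -> R)) : inhabited T ->
  K `<=` bounded_function -> K 0 ->
  (forall f g, K f -> K g -> K (f + g)) ->
  (forall (t : R) f, 0 <= t -> K f -> K (t *: f)) ->
  (forall f (e : R), K f -> 0 < e -> exists x, - e < f x) ->
  exists2 L, mean L & forall f, K f -> 0 <= L f.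
Proof.
move=> T0 Kb K0 KD KZ Kpos.
have sq : sublinear sup_bfun.
  split=> [f g|t f t0].
    by apply: sup_bfun_le => // x; rewrite lerD// sup_bfun_ub.
  by apply: sup_bfun_le => // x; rewrite ler_wpM2l// sup_bfun_ub.
have [||||l [llin lle lK]] := @hahn_banach_cone R bfun_type sup_bfun
    (fun f : bfun_type => K (bfun_val f)) sq.
- exact: K0.
- by move=> f g; exact: KD.
- by move=> t f; exact: KZ.
- move=> f Kf; rewrite leNgt; apply/negP => f0.
  have [|x] := Kpos _ (- sup_bfun f) Kf; first by rewrite oppr_gt0.
  by rewrite opprK ltNge sup_bfun_ub.
(* Off the bounded functions [L] takes the default value 0; [mean] constrains it on bounded
   functions only. *)
pose L f := if pselect (f \in bfun) is left bf then l (BFun bf) else 0.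
have LE f (bf : f \in bfun) : L f = l (BFun bf).
  rewrite /L; case: pselect => // bf'; congr l; exact: val_inj.
have l0 : l 0 = 0 by have := llin 1 0 0; rewrite scale1r addr0; lra.
have lN (f : bfun_type) : l (- f) = - l f by have := llin (-1) f 0; rewrite addr0 scaleN1r l0; lra.
exists L; last first.
  move=> f Kf; have /bounded_functionP bf := Kb _ Kf.
  by rewrite (LE _ bf); exact: lK.
split=> [a f g bf bg|f bf f0|].
- have /bounded_functionP bfg := bounded_function_lin a bf bg.
  move: bf bg => /bounded_functionP bf /bounded_functionP bg.
  rewrite (LE _ bf) (LE _ bg) (LE _ bfg) -llin; congr l; exact: val_inj.
- move: bf => /bounded_functionP bf; rewrite (LE _ bf) -lerN2 oppr0 -lN.
  apply: le_trans (lle _) _; apply: sup_bfun_le => // x.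
  by rewrite oppr_le0 f0.
- have /bounded_functionP b1 := bounded_function_cst 1.
  rewrite (LE _ b1); apply/eqP; rewrite eq_le; apply/andP; split.
    by apply: le_trans (lle _) _; apply: sup_bfun_le.
  rewrite -lerN2 -lN; apply: le_trans (lle _) _; exact: sup_bfun_le.
Qed.

Section MeanTheory.
Variable L : (T -> R) -> R.
Hypothesis mL : mean L.

Lemma meanD f g : bounded_function f -> bounded_function g ->
  L (f + g) = L f + L g.
Proof. by case: mL => lin _ _ bf bg; rewrite -[f]scale1r lin// mul1r scale1r. Qed.

Lemma mean0 : L 0 = 0.
Proof.
have b0 := bounded_function_cst 0.
have := meanD b0 b0; rewrite (_ : cst 0 + cst 0 = 0); last first.
  by apply/funext => x; exact: addr0.
by rewrite (_ : cst 0 = 0)//; lra.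
Qed.

Lemma meanZ (a : R) f : bounded_function f -> L (a *: f) = a * L f.
Proof.
case: mL => lin _ _ bf; have := lin a f 0 bf (bounded_function_cst 0).
by rewrite addr0 mean0 addr0.
Qed.

Lemma meanB f g : bounded_function f -> bounded_function g ->
  L (f - g) = L f - L g.
Proof.
case: mL => lin _ _ bf bg; have := lin (-1) g f bg bf.
by rewrite scaleN1r mulN1r ![- _ + _]addrC.
Qed.

Lemma le_mean f g : bounded_function f -> bounded_function g ->
  (forall x, f x <= g x) -> L f <= L g.
Proof.
move=> bf bg fg; rewrite -subr_ge0 -meanB//; case: mL => _ pos _.
apply: pos; last by move=> x; rewrite subr_ge0.
by rewrite addrC -scaleN1r; exact: bounded_function_lin.
Qed.

Lemma mean_cst (c : R) : L (cst c) = c.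
Proof.
have -> : cst c = c *: cst 1 :> (T -> R) by apply/funext => x; exact/esym/mulr1.
by rewrite meanZ; [case: mL => _ _ ->; rewrite mulr1|exact: bounded_function_cst].
Qed.

(** Boundedness of the partial sums is carried through the induction because [meanD] asks for it. *)
Lemma mean_sum n (F : 'I_n -> T -> R) : (forall i, bounded_function (F i)) ->
  bounded_function (\sum_(i < n) F i) /\ L (\sum_(i < n) F i) = \sum_(i < n) L (F i).
Proof.
elim: n F => [|n IH] F bF.
  by rewrite !big_ord0 mean0; split => //; exact: bounded_function_cst.
rewrite !big_ord_recr /=.
have [b LE] := IH (fun i => F (widen_ord (leqnSn n) i)) (fun i => bF _).
rewrite meanD// LE; split => //.
by rewrite -[X in X + _]scale1r; exact: bounded_function_lin.
Qed.

End MeanTheory.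
End Mean.

(** * From finitely additive to Borel probabilities *)

(** Normalizing packages [mu] as a probability; as the total mass is 1, the values do not change and
    the fallback [dirac point] never occurs. *)
Lemma measure_probability (R : realType) d (T : measurableType d)
    (mu : {measure set T -> \bar R}) : mu setT = 1%E ->
  exists P : probability T R, forall B, P B = mu B.
Proof.
move=> mu1; exists (mnormalize mu (dirac point)) => B.
rewrite /= /mnormalize mu1 ifF; first by rewrite /= invr1 mule1.
by rewrite onee_eq0 /=; apply/negbTE; rewrite -ltey ltry.
Qed.

Section ContentExtension.
Local Open Scope ereal_scope.
Context {R : realType} {T : ptopologicalType}.
Hypothesis T_compact : compact [set: T].
Hypothesis T_hausdorff : hausdorff_space T.
Variable lam : set T -> R.
Hypothesis lam0 : lam set0 = 0%R.
Hypothesis lamT : lam setT = 1%R.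
Hypothesis le_lam : forall A B, A `<=` B -> (lam A <= lam B)%R.
Hypothesis lamU : forall A B, A `&` B = set0 ->
  (lam (A `|` B) = lam A + lam B)%R.
Implicit Types (A B E F U V : set T).

Let lam_ge0 A : (0 <= lam A)%R.
Proof. by rewrite -lam0; exact: le_lam. Qed.

Let lamU_le A B : (lam (A `|` B) <= lam A + lam B)%R.
Proof.
rewrite (_ : A `|` B = A `|` (B `\` A)); last by rewrite setUDr setDv setD0.
rewrite lamU; first by rewrite lerD2l; apply: le_lam => x [].
by rewrite setDE setICA setICr setI0.
Qed.

(** [lam] is only finitely additive. Restricting to closed subsets, which are compact here, reduces
    countable open covers to finite ones and so yields countable subadditivity on open sets. *)
Let inner U : \bar R :=
  ereal_sup [set (lam F)%:E | F in [set F | closed F /\ F `<=` U]].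

Let outer E : \bar R :=
  ereal_inf [set inner U | U in [set U | open U /\ E `<=` U]].

Let inner_ge U F : closed F -> F `<=` U -> (lam F)%:E <= inner U.
Proof. by move=> cF FU; apply: ereal_sup_ubound; exists F. Qed.

Let inner_leP U (x : \bar R) :
  (forall F, closed F -> F `<=` U -> (lam F)%:E <= x) -> inner U <= x.
Proof. by move=> h; apply: ge_ereal_sup => _ [F [cF FU] <-]; exact: h. Qed.

Let inner_ge0 U : 0 <= inner U.
Proof. by have := inner_ge closed0 (sub0set U); rewrite lam0. Qed.

Let inner_le_lam U : inner U <= (lam U)%:E.
Proof. by apply: inner_leP => F _ FU; rewrite lee_fin le_lam. Qed.

Let le_inner U V : U `<=` V -> inner U <= inner V.
Proof.
by move=> UV; apply: inner_leP => F cF FU; apply: inner_ge => // x /FU/UV.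
Qed.

Let inner_fin U : inner U \is a fin_num.
Proof.
by rewrite ge0_fin_numE// (le_lt_trans (inner_le_lam U))// ltry.
Qed.

(** By normality, disjoint open sets [W] and [W'] separate [F \ V] from [F \ U]. Then [F \ W'] lies
    in [U], [F \ W] lies in [V], both are closed, and together they cover [F]. *)
Let innerU U V : open U -> open V -> inner (U `|` V) <= inner U + inner V.
Proof.
move=> oU oV; apply: inner_leP => F cF FUV.
have /(@normal_openP R) nT := compact_normal T_hausdorff T_compact.
have cFU : closed (F `\` U) by rewrite setDE; apply: closedI => //; exact: open_closedC.
have cFV : closed (F `\` V) by rewrite setDE; apply: closedI => //; exact: open_closedC.
have [|W [W' [oW oW' FW FW' WW']]] := nT _ _ cFV cFU.
  by rewrite -subset0 => x [[Fx nVx] [_ nUx]]; case: (FUV _ Fx).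
have FE : F `<=` (F `\` W') `|` (F `\` W).
  move=> x Fx; have [W'x|W'x] := pselect (W' x); last by left.
  by right; split => // Wx; have : (W `&` W') x by []; rewrite WW'.
apply: (@le_trans _ _ ((lam (F `\` W'))%:E + (lam (F `\` W))%:E)).
  by rewrite -EFinD lee_fin; apply: le_trans (lamU_le _ _); exact: le_lam.
apply: leeD; apply: inner_ge; rewrite ?setDE.
- by apply: closedI => //; exact: open_closedC.
- by move=> x [Fx nW'x]; apply: contrapT => nUx; exact/nW'x/FW'.
- by apply: closedI => //; exact: open_closedC.
- by move=> x [Fx nWx]; apply: contrapT => nVx; exact/nWx/FW.
Qed.

Let inner_bigsetU (U : (set T)^nat) n : (forall i, open (U i)) ->
  inner (\big[setU/set0]_(i < n) U i) <= \sum_(i < n) inner (U i).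
Proof.
move=> oU; elim: n => [|n IH].
  by rewrite !big_ord0 (le_trans (inner_le_lam _))// lam0.
rewrite !big_ord_recr /=; apply: le_trans (leeD2r _ IH).
by apply: innerU => //; rewrite -bigcup_mkord; exact: bigcup_open.
Qed.

Let inner_bigcup (U : (set T)^nat) : (forall i, open (U i)) ->
  inner (\bigcup_i U i) <= \sum_(i <oo) inner (U i).
Proof.
move=> oU; apply: inner_leP => F cF FU.
have : cover_compact F.
  by rewrite -compact_cover; exact: subclosed_compact cF T_compact _.
move=> /(_ nat setT U (fun i _ => oU i)); rewrite /cover => /(_ FU)[D _ FD].
(* The subcover is indexed by an arbitrary finite set [D]; one more than its maximum gives an
   initial segment containing it. *)
pose n := (\max_(i <- finmap.enum_fset D) i).+1.
apply: (@le_trans _ _ (inner (\big[setU/set0]_(i < n) U i))).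
  apply: inner_ge => // x /FD[i /= iD Uix].
  rewrite -bigcup_mkord; exists i => //=.
  by rewrite /n ltnS; apply: leq_bigmax_seq.
apply: le_trans (inner_bigsetU _ oU) _.
rewrite -(big_mkord xpredT (fun i => inner (U i))).
exact: nneseries_lim_ge.
Qed.

Let outer_open U : open U -> outer U = inner U.
Proof.
move=> oU; apply/eqP; rewrite eq_le; apply/andP; split.
  by apply: ereal_inf_lbound; exists U => //; split.
by apply: le_ereal_inf_tmp => _ [V [oV UV] <-]; exact: le_inner.
Qed.

Let outer_ge0 E : 0 <= outer E.
Proof. by apply: le_ereal_inf_tmp => _ [V _ <-]. Qed.

Let outer0 : outer set0 = 0.
Proof.
rewrite outer_open; last exact: open0.
by apply/eqP; rewrite eq_le inner_ge0 andbT (le_trans (inner_le_lam _))// lam0.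
Qed.

Let le_outer : {homo outer : A B / A `<=` B >-> A <= B}.
Proof.
move=> A B AB; apply: le_ereal_inf => _ [U [oU BU] <-].
by exists U => //; split => // x /AB /BU.
Qed.

Let outer_fin E : outer E \is a fin_num.
Proof.
rewrite ge0_fin_numE// (le_lt_trans (le_outer (@subsetT _ E)))//.
by rewrite outer_open ?ltey_eq ?inner_fin//; exact: openT.
Qed.

Let outer_adherent E (e : R) : (0 < e)%R ->
  exists U, [/\ open U, E `<=` U & inner U <= outer E + e%:E].
Proof.
move=> e0; have [_ [U [oU EU] <-] h] := lb_ereal_inf_adherent e0 (outer_fin E).
by exists U; split => //; exact: ltW.
Qed.

Let outer_sigma_subadditive : sigma_subadditive outer.
Proof.
move=> E; apply/lee_addgt0Pr => e e0.
have /choice[U UP] (i : nat) : exists U, [/\ open U, E i `<=` U &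
    inner U <= outer (E i) + (e / (2 ^ i.+1)%:R)%:E].
  by apply: outer_adherent; rewrite divr_gt0// ltr0n expn_gt0.
have oU i : open (U i) by have [] := UP i.
apply: le_trans (epsilon_trick xpredT _ (ltW e0)) => //.
apply: (@le_trans _ _ (\sum_(i <oo) inner (U i))).
  apply: le_trans (inner_bigcup oU); rewrite -outer_open; last exact: bigcup_open.
  by apply: le_outer => x [i _ Eix]; exists i => //; have [_ + _] := UP i; exact.
by apply: lee_nneseries => // i _; have [] := UP i.
Qed.

(** Take [V] open around [E] and almost optimal. If [F] is closed in [V & U] and [G] is closed in
    [V \ F], then [F] and [G] are disjoint and their union is closed in [V], so lam F + lam G <=
    inner V. Since [V \ F] is an open set containing [V \ U], suprema over [G] and then over [F]
    give the required splitting of [E]. *)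
Let outer_caratheodory U : open U -> outer.-caratheodory U.
Proof.
move=> oU.
pose mu : {outer_measure set T -> \bar R} := HB.pack outer
  (isOuterMeasure.Build R T outer outer0 outer_ge0 le_outer
     outer_sigma_subadditive).
apply: (@le_caratheodory_measurable _ _ mu) => E; rewrite /mu /=.
apply/lee_addgt0Pr => e e0; have [V [oV EV VE]] := outer_adherent E e0.
apply: le_trans VE.
apply: (@le_trans _ _ (inner (V `&` U) + outer (V `\` U))).
  apply: leeD; last by apply: le_outer => x [/EV].
  by rewrite -outer_open; [apply: le_outer => x [/EV]|exact: openI].
rewrite -leeBrDr//; apply: inner_leP => F cF FVU; rewrite leeBrDr//.
apply: (@le_trans _ _ ((lam F)%:E + inner (V `\` F))).
  apply: leeD => //; apply: ereal_inf_lbound; exists (V `\` F) => //; split.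
    by rewrite setDE; apply: openI => //; exact: closed_openC.
  by move=> x [Vx nUx]; split => // /FVU[].
rewrite -leeBrDl//; apply: inner_leP => G cG GVF; rewrite leeBrDl// -EFinD.
rewrite -lamU; last by rewrite -subset0 => x [Fx /GVF[]].
by apply: inner_ge; [exact: closedU|move=> x [/FVU[]|/GVF[]]].
Qed.

(** Borel sets are Caratheodory measurable because open sets are. On open sets [outer] agrees with
    [inner], which never exceeds [lam] but may be smaller: this is why only an inequality is
    claimed. *)
Lemma content_extension :
  exists pi : prior R T, forall U, open U -> pi U <= (lam U)%:E.
Proof.
pose mu : {outer_measure set T -> \bar R} := HB.pack outer
  (isOuterMeasure.Build R T outer outer0 outer_ge0 le_outer
     outer_sigma_subadditive).
pose B := g_sigma_algebraType (@open T).
have mB (E : set B) : measurable E -> mu.-cara.-measurable E.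
  move: E; apply: smallest_sub; last first.
    by move=> U oU; exact: (outer_caratheodory oU).
  split; [exact: measurable0|by move=> A mA; rewrite setTD; exact: measurableC|].
  by move=> F mF; apply: bigcup_measurable => i _; exact: mF.
have sadd : semi_sigma_additive (outer : set B -> \bar R).
  move=> F mF tF mUF; apply: (@measure_semi_sigma_additive _ _ _
    (mu : {measure set (caratheodory_type mu) -> \bar R})) => //.
  - by move=> i; exact: mB.
  - exact: mB.
(* The whole space is closed, hence its own closed approximation: no total mass is lost. *)
have outerT : outer (setT : set B) = 1.
  rewrite outer_open; last exact: openT.
  apply/eqP; rewrite eq_le -lamT inner_le_lam/=.
  by apply: inner_ge => //; exact: closedT.
pose nu : {measure set B -> \bar R} := HB.pack (outer : set B -> \bar R)
  (isMeasure.Build _ B R (outer : set B -> \bar R) outer0 outer_ge0 sadd).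
have [P PE] := @measure_probability _ _ _ nu outerT.
by exists P => U oU; rewrite PE /nu /= outer_open//; exact: inner_le_lam.
Qed.

End ContentExtension.

(** * Integrals of continuous functions against the Borel probability *)

Section BorelIntegral.
Context {R : realType} {T : ptopologicalType}.
Let B := g_sigma_algebraType (@open T).

Lemma open_borel (U : set T) : open U -> measurable (U : set B).
Proof. by move=> oU; exact: sub_sigma_algebra. Qed.

Lemma open_superlevel (f : T -> R) (t : R) : continuous f -> open [set x | t < f x].
Proof.
by move=> cf; apply: (@open_comp _ _ f [set y | t < y]); [move=> x _; exact: cf|exact: open_gt].
Qed.

Lemma continuous_borel (f : T -> R) : continuous f ->
  measurable_fun [set: B] (f : B -> R).
Proof.
move=> cf; apply: (measurability _ (RGenOInfty.measurableE R)).
move=> _ [_ [t ->] <-]; rewrite setTI; apply: open_borel.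
rewrite (_ : _ @^-1` _ = [set x | t < f x]); first exact: open_superlevel.
by apply/seteqP; split=> x /=; rewrite in_itv/= andbT.
Qed.

Lemma compact_bounded_function (f : T -> R) : compact [set: T] ->
  (forall x, 0 <= f x) -> continuous f -> bounded_function f.
Proof.
move=> cT f0 cf; have [||c _ fc] := compact_EVT_max _ cT (f := f).
- by exists point.
- exact: continuous_subspaceT.
by exists (f c) => x; rewrite ger0_norm// fc// inE.
Qed.

(** The sum counts the k, starting at 0, with k e < y, so it rounds y up to a multiple of [e]. The
    strict inequality is what makes the level sets of a continuous function open. *)
Lemma staircase_bounds n (e y : R) : 0 < e -> 0 <= y -> y <= n%:R * e ->
  y <= \sum_(k < n) e * (k%:R * e < y)%R%:R <= y + e.
Proof.
move=> e0 y0; elim: n => [|n IH] yn.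
  by rewrite big_ord0; move: yn; rewrite mul0r => yn; rewrite yn/=; lra.
rewrite big_ord_recr /=; have [ny|yn'] := ltP (n%:R * e) y; last first.
  by rewrite mulr0 addr0 IH.
rewrite (eq_bigr (fun=> e)) => [|k _].
  rewrite sumr_const card_ord -[e *+ n]mulr_natl mulr1.
  by move: yn; rewrite -natr1 mulrDl mul1r => yn; rewrite yn/=; lra.
rewrite (le_lt_trans _ ny) ?mulr1// ler_wpM2r ?(ltW e0)// ler_nat.
exact/ltnW/ltn_ord.
Qed.

(* Layer cake: [f <= sum_k e 1_(k e < f) <= f + e]. *)
Lemma le_integral_mean (L : (T -> R) -> R) (pi : prior R T) (f : T -> R) :
  mean L -> (forall U, open U -> (pi U <= (L \1_U)%:E)%E) ->
  continuous f -> (forall x, 0 <= f x) -> bounded_function f ->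
  (\int[pi]_x (f x)%:E <= (L f)%:E)%E.
Proof.
move=> mL piL cf f0 bf; apply/lee_addgt0Pr => e e0.
have [M fM] := bf.
have M0 : 0 <= M := le_trans (normr_ge0 _) (fM point).
pose n := Num.Def.archi_bound (M / e).
have Mn : M <= n%:R * e.
  by rewrite -ler_pdivrMr// ltW// archi_boundP// divr_ge0// ltW.
pose U (k : 'I_n) := [set x | k%:R * e < f x].
have oU k : open (U k) by exact: open_superlevel.
pose F (k : 'I_n) : T -> R := e *: \1_(U k).
have FE x : \sum_(k < n) F k x = \sum_(k < n) e * (k%:R * e < f x)%R%:R.
  apply: eq_bigr => k _; rewrite /F /= -[LHS]/(e * \1_(U k) x) indicE.
  congr (_ * _%:R); congr nat_of_bool.
  by apply/idP/idP; rewrite inE.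
have bnd x : f x <= \sum_(k < n) F k x <= f x + e.
  rewrite FE; apply: staircase_bounds => //.
  by apply: le_trans (le_trans (ler_norm _) (fM x)) Mn.
have bF k : bounded_function (F k).
  have := bounded_function_lin e (bounded_indic (U k)) (bounded_function_cst 0).
  by rewrite addr0.
have [bS LS] := mean_sum mL bF.
have mI k : measurable_fun [set: B] (fun x : B => (\1_(U k) x)%:E : \bar R).
  by apply/measurable_EFinP; apply: measurable_indic; exact: open_borel.
have mF k : measurable_fun [set: B] (fun x : B => (F k x)%:E : \bar R).
  under eq_fun do rewrite /F -[X in X%:E]/(e * \1_(U k) _) EFinM.
  exact: measurable_funeM.
have F0 k x : 0 <= F k x.
  by rewrite -[F k x]/(e * \1_(U k) x) mulr_ge0// ltW.
apply: (@le_trans _ _ (\int[pi]_x (\sum_(k < n) (F k x)%:E))%E).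
  apply: ge0_le_integral => //.
  - by move=> x _; rewrite lee_fin.
  - by apply/measurable_EFinP; exact: continuous_borel.
  - by apply: emeasurable_sum.
  - by move=> x _; rewrite sumEFin lee_fin; have /andP[] := bnd x.
rewrite ge0_integral_sum//; last by move=> k x _; rewrite lee_fin.
(* Each level set [U k] is open, so [piL] bounds its measure by its mean. *)
apply: (@le_trans _ _ (\sum_(k < n) (L (F k))%:E)%E).
  apply: lee_sum => k _; rewrite /F meanZ; [|exact: mL|exact: bounded_indic].
  under eq_integral do rewrite -[X in X%:E]/(e * \1_(U k) _) EFinM.
  rewrite ge0_integralZl_EFin//; last by exact: ltW.
  rewrite integral_indic//; last exact: open_borel.
  by rewrite setIT EFinM lee_pmul2l// piL.
rewrite sumEFin -LS -EFinD lee_fin -[in leRHS](mean_cst mL e) -meanD//; last first.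
  exact: bounded_function_cst.
apply: le_mean => //.
  by rewrite -[f]scale1r; apply: bounded_function_lin => //; exact: bounded_function_cst.
by move=> x; rewrite fct_sumE; have /andP[] := bnd x.
Qed.

(** The reverse inequality is [le_integral_mean] for M - f, with M a bound of f: the integrals of f
    and M - f add up to M, and so do their means. *)
Lemma integral_mean (L : (T -> R) -> R) (pi : prior R T) (f : T -> R) :
  mean L -> (forall U, open U -> (pi U <= (L \1_U)%:E)%E) ->
  continuous f -> (forall x, 0 <= f x) -> bounded_function f ->
  (\int[pi]_x (f x)%:E = (L f)%:E)%E.
Proof.
move=> mL piL cf f0 bf.
apply/eqP; rewrite eq_le le_integral_mean//=.
have [M fM] := bf.
have Mf0 x : 0 <= M - f x by rewrite subr_ge0 (le_trans (ler_norm _)).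
have bMf : bounded_function (cst M - f).
  rewrite addrC -scaleN1r; apply: bounded_function_lin => //.
  exact: bounded_function_cst.
have cMf : continuous (cst M - f).
  by move=> x; apply: continuousB; [exact: cst_continuous|exact: cf].
have := @le_integral_mean L pi (cst M - f) mL piL cMf Mf0 bMf.
rewrite meanB//; last exact: bounded_function_cst.
rewrite mean_cst//.
have mf : measurable_fun [set: B] (fun x : B => (f x)%:E : \bar R).
  by apply/measurable_EFinP; exact: continuous_borel.
have mMf : measurable_fun [set: B] (fun x : B => ((cst M - f) x)%:E : \bar R).
  by apply/measurable_EFinP; exact: continuous_borel.
have : (\int[pi]_x (f x)%:E + \int[pi]_x ((cst M - f) x)%:E = M%:E)%E.
  rewrite -ge0_integralD//; last 2 first.
  - by move=> x _; rewrite lee_fin.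
  - by move=> x _; rewrite lee_fin; exact: Mf0.
  rewrite (eq_integral (cst M%:E)) => [|x _].
    rewrite integral_cst//; rewrite -[RHS]mule1.
    by congr (_ * _)%E; exact: (@probability_setT _ _ _ pi).
  by rewrite -EFinD /=; congr EFin; rewrite addrC; exact: subrK.
have If : (\int[pi]_x (f x)%:E)%E \is a fin_num.
  rewrite ge0_fin_numE; last by apply: integral_ge0 => x _; rewrite lee_fin.
  by apply: le_lt_trans (le_integral_mean mL piL cf f0 bf) _; rewrite ltry.
rewrite -(fineK If); case: (\int[pi]_x ((cst M - f) x)%:E)%E => [r||]//.
by rewrite -EFinD => -[h]; rewrite !lee_fin; lra.
Qed.

End BorelIntegral.

(** * Minimax *)

Section Minimax.
Context {R : realType} {T : ptopologicalType}.

(** The differences f - f0 with f in [K] generate a convex cone containing no uniformly negative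
    function. [mean_cone] gives a mean for which f0 is minimal, and [content_extension] a Borel
    probability with the same values on [K] and f0. *)
Lemma minimax_prior (K : set (T -> R)) (f0 : T -> R) :
  compact [set: T] -> hausdorff_space T ->
  (forall f, K f -> continuous f) -> (forall f, K f -> forall x, 0 <= f x) ->
  continuous f0 -> (forall x, 0 <= f0 x) ->
  (forall n (p : 'I_n -> R) (f : 'I_n -> T -> R) (e : R), convex_weights p ->
    (forall i, K (f i)) -> 0 < e ->
    ~ forall x, \sum_(i < n) p i * f i x <= f0 x - e) ->
  exists pi : prior R T, (\int[pi]_x (f0 x)%:E < +oo)%E /\
    forall f, K f -> (\int[pi]_x (f0 x)%:E <= \int[pi]_x (f x)%:E)%E.
Proof.
move=> cT hT Kc K0 cf0 f00 Kf0.
have bf0 : bounded_function f0 by exact: compact_bounded_function.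
have bK f : K f -> bounded_function f.
  by move=> Kf; apply: compact_bounded_function; [|exact: K0|exact: Kc].
have bB f : bounded_function f -> bounded_function (f - f0).
  by move=> bf; rewrite addrC -scaleN1r; exact: bounded_function_lin.
(* Nonnegative combinations are kept as lists of weighted functions: concatenation adds them,
   rescaling the weights multiplies them. *)
pose ok (s : seq (R * (T -> R))) := forall x, x \in s -> 0 <= x.1 /\ K x.2.
pose comb (s : seq (R * (T -> R))) : T -> R := \sum_(x <- s) x.1 *: (x.2 - f0).
have combE s y : comb s y = \sum_(x <- s) x.1 * (x.2 y - f0 y).
  by rewrite /comb fct_sumE.
pose C := [set f | exists2 s, ok s & f = comb s].
have [||||||L mL LC] := @mean_cone R T C.
- exact: inhabits point.
- move=> _ [s oks ->]; rewrite /comb; elim: s oks => [|x s IH] oks.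
    by rewrite big_nil; exact: bounded_function_cst.
  rewrite big_cons; apply: bounded_function_lin.
    by apply/bB/bK; have [] := oks x (mem_head x s).
  by apply: IH => y ys; apply: oks; rewrite inE ys orbT.
- by exists [::] => //; rewrite /comb big_nil.
- move=> _ _ [s oks ->] [s' oks' ->]; exists (s ++ s'); last by rewrite /comb big_cat.
  by move=> x; rewrite mem_cat => /orP[/oks|/oks'].
- move=> t _ t0 [s oks ->]; exists [seq (t * x.1, x.2) | x <- s].
    move=> x /mapP[y /oks[y0 Ky] ->]; split => //=; exact: mulr_ge0.
  by rewrite /comb big_map scaler_sumr; apply: eq_bigr => x _; rewrite scalerA.
- move=> _ e [s oks ->] e0; apply: contrapT => /forallNP nex.
  have ub x : comb s x <= - e by rewrite leNgt; apply/negP; exact: nex.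
  have ok_nth (i : 'I_(size s)) : 0 <= (tnth (in_tuple s) i).1 /\
      K (tnth (in_tuple s) i).2.
    by apply: oks; exact: mem_tnth.
  (* A combination below - e has positive total weight [c], since otherwise all weights vanish and
     it is 0. Dividing by [c] gives a convex combination of members of [K] that lies below f0 by e /
     c everywhere, against [Kf0]. *)
  pose c := \sum_(x <- s) x.1.
  have cE : c = \sum_(i < size s) (tnth (in_tuple s) i).1 by rewrite /c big_tnth.
  have c0 : 0 <= c by rewrite cE; apply: sumr_ge0 => i _; have [] := ok_nth i.
  have [cz|cn0] := eqVneq c 0.
    have z i : (tnth (in_tuple s) i).1 = 0.
      move/eqP: cz; rewrite cE psumr_eq0; last by move=> j _; have [] := ok_nth j.
      by move/allP => /(_ i (mem_index_enum _))/eqP.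
    have := ub point; rewrite combE big_tnth big1 => [|i _]; last by rewrite z mul0r.
    by rewrite leNgt oppr_lt0 e0.
  have c_gt0 : 0 < c by rewrite lt_neqAle eq_sym cn0.
  apply: (Kf0 _ (fun i => (tnth (in_tuple s) i).1 / c)
    (fun i => (tnth (in_tuple s) i).2) (e / c)).
  + split; first by move=> i; apply: divr_ge0 => //; have [] := ok_nth i.
    by rewrite -mulr_suml -cE mulfV.
  + by move=> i; have [] := ok_nth i.
  + exact: divr_gt0.
  + move=> x; have := ub x; rewrite combE big_tnth => h.
    have -> : \sum_(i < size s) (tnth (in_tuple s) i).1 / c * (tnth (in_tuple s) i).2 x
      = f0 x + (\sum_(i < size s) (tnth (in_tuple s) i).1 *
                  ((tnth (in_tuple s) i).2 x - f0 x)) / c.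
      under [in RHS]eq_bigr do rewrite mulrBr.
      rewrite sumrB -mulr_suml -cE mulrBl mulrAC mulfV// mul1r addrC subrK.
      by rewrite mulr_suml; apply: eq_bigr => i _; rewrite mulrAC.
    by rewrite lerD2l -mulNr ler_pM2r// invr_gt0.
have [||||pi piL] := @content_extension R T cT hT (fun A => L \1_A).
- have -> : \1_set0 = 0 :> (T -> R) by apply/funext => x; rewrite indicE in_set0.
  exact: mean0.
- have -> : \1_setT = cst 1 :> (T -> R) by apply/funext => x; rewrite indicE in_setT.
  exact: mean_cst.
- move=> A B AB; apply: le_mean => //; [exact: bounded_indic|exact: bounded_indic|].
  move=> x; rewrite !indicE ler_nat; have [xA|//] := boolP (x \in A).
  by rewrite (mem_set (AB _ (set_mem xA))).
- move=> A B AB0; rewrite -meanD//; [|exact: bounded_indic|exact: bounded_indic].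
  congr L; apply/funext => x.
  rewrite -[RHS]/(\1_A x + \1_B x) !indicE in_setU.
  have [xA|_] := boolP (x \in A); have [xB|_] := boolP (x \in B) => /=.
  + by have : (A `&` B) x; [split; exact: set_mem|rewrite AB0].
  + by rewrite addr0.
  + by rewrite add0r.
  + by rewrite addr0.
have I0 := integral_mean mL piL cf0 f00 bf0.
exists pi; rewrite I0; split; first exact: ltry.
move=> f Kf; rewrite (integral_mean mL piL (Kc f Kf) (K0 f Kf) (bK f Kf)) lee_fin.
rewrite -subr_ge0 -meanB//; last exact: bK.
apply: LC; exists [:: (1, f)]; last by rewrite /comb big_seq1 scale1r.
by move=> x; rewrite inE => /eqP->; split.
Qed.

End Minimax.

(** * Decision procedures *)

(** Induction peels off the last weight [q] and divides the others by 1 - q; the case q = 1 is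
    separate, the other weights being 0 there. *)
Lemma convex_function_sum (R : realType) (E : lmodType R) (f : E -> R) :
  @convex_function R E [set: E] f ->
  forall n (p : 'I_n -> R) (a : 'I_n -> E), convex_weights p ->
  f (\sum_(i < n) p i *: a i) <= \sum_(i < n) p i * f (a i).
Proof.
move=> cf; elim=> [|n IH] p a [p0 p1].
  by move: p1; rewrite big_ord0 => /eqP; rewrite eq_sym oner_eq0.
rewrite !big_ord_recr /=; move: p1; rewrite big_ord_recr /=.
set q := p ord_max; set w := widen_ord (leqnSn n) => p1.
have q0 : 0 <= q := p0 _.
have s0 : 0 <= \sum_(i < n) p (w i) by apply: sumr_ge0.
have q1 : q <= 1 by lra.
have [qE|qn1] := eqVneq q 1.
  have pw i : p (w i) = 0.
    have : \sum_(i < n) p (w i) == 0 by apply/eqP; lra.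
    by rewrite psumr_eq0// => /allP/(_ i (mem_index_enum _))/eqP.
  rewrite !big1 ?add0r ?qE ?scale1r ?mul1r// => i _; first by rewrite pw mul0r.
  by rewrite pw scale0r.
have s_gt0 : 0 < 1 - q by rewrite subr_gt0 lt_neqAle qn1.
have {}IH := IH (fun i => p (w i) / (1 - q)) (fun i => a (w i)).
have wts : convex_weights (fun i => p (w i) / (1 - q)).
  split; first by move=> i; rewrite divr_ge0// ltW.
  have -> : \sum_(i < n) p (w i) / (1 - q) = (1 - q) / (1 - q).
    by rewrite -mulr_suml; congr (_ / _); lra.
  by rewrite mulfV// gt_eqF.
have {wts}IH := IH wts.
pose t := Itv01 q0 q1.
have := cf t (a ord_max) (\sum_(i < n) (p (w i) / (1 - q)) *: a (w i)).
rewrite !inE => /(_ I I).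
set b := \sum_(i < n) _ => h.
have {}h : f (q *: a ord_max + (1 - q) *: b) <= q * f (a ord_max) + (1 - q) * f b := h.
have -> : \sum_(i < n) p (w i) *: a (w i) + q *: a ord_max =
    q *: a ord_max + (1 - q) *: b.
  rewrite addrC scaler_sumr; congr (_ + _); apply: eq_bigr => i _.
  by rewrite scalerA mulrC divfK// gt_eqF.
apply: le_trans h _; rewrite addrC lerD2l.
apply: le_trans (ler_wpM2l (ltW s_gt0) IH) _.
rewrite mulr_sumr; apply: ler_sum => i _.
by rewrite mulrA [_ * (_ / _)]mulrC divfK// gt_eqF.
Qed.

(** * Finite mixtures of probability measures *)

Section Mixture.
Local Open Scope ereal_scope.
Context {R : realType} {d : measure_display} {A : measurableType d}.
Variables (n : nat) (p : 'I_n -> R) (m : 'I_n -> probability A R).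
Hypothesis wp : convex_weights p.

(** [msum] takes a sequence of measures indexed by [nat]; [mzero] fills the indices from [n] on. *)
Let summand (i : nat) : {measure set A -> \bar R} :=
  if insub i is Some j then mscale (NngNum (wp.1 j)) (m j) else mzero.

Let summandE (j : 'I_n) : summand j = mscale (NngNum (wp.1 j)) (m j).
Proof. by rewrite /summand valK. Qed.

Let msumE B : msum summand n B = \sum_(i < n) (p i)%:E * m i B.
Proof. by apply: eq_bigr => i _; rewrite summandE. Qed.

Lemma mixture_exists :
  exists P : probability A R, forall B, P B = \sum_(i < n) (p i)%:E * m i B.
Proof.
have [|P PE] := @measure_probability R _ A (msum summand n).
  rewrite /= msumE (eq_bigr (fun i => (p i)%:E)) => [|i _].
    by rewrite sumEFin wp.2.
  by rewrite probability_setT mule1.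
by exists P => B; rewrite PE -msumE.
Qed.

(** [P] is an arbitrary probability with the values of the mixture on measurable sets, as in
    [is_combination]; such agreement already determines integrals. *)
Lemma integral_mixture (P : probability A R) (f : A -> \bar R) :
  (forall B, measurable B -> P B = \sum_(i < n) (p i)%:E * m i B) ->
  (forall a, 0 <= f a) -> measurable_fun setT f ->
  \int[P]_a f a = \sum_(i < n) (p i)%:E * \int[m i]_a f a.
Proof.
move=> PE f0 mf.
rewrite (@eq_measure_integral _ _ _ setT (msum summand n)) => [|B mB _]; last first.
  by rewrite [LHS]PE//= msumE.
rewrite ge0_integral_measure_sum//; apply: eq_bigr => i _.
by rewrite summandE ge0_integral_mscale.
Qed.

End Mixture.

(** * Risks, admissibility and Bayes procedures *)

Section Decision.
Context {R : realType} {dX dA : measure_display}.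
Context {X : measurableType dX} {A : measurableType dA}.
Context {Theta : ptopologicalType}.
Variables (loss : Theta -> A -> R) (P : Theta -> probability X R).
Hypothesis loss_ge0 : forall theta a, 0 <= loss theta a.
Hypothesis loss_meas : forall theta, measurable_fun [set: A] (loss theta).
Hypothesis Theta_compact : compact [set: Theta].
Hypothesis Theta_hausdorff : hausdorff_space Theta.
Hypothesis risk_continuous : forall delta, procD loss P delta ->
  continuous (fun theta => risk loss P theta delta).
Implicit Types (delta : X -> probability A R) (C : set (X -> probability A R)).

Lemma measurable_loss theta :
  measurable_fun [set: A] (fun a => (loss theta a)%:E : \bar R).
Proof. exact/measurable_EFinP. Qed.

Lemma expected_loss_ge0 theta (m : probability A R) :
  (0 <= expected_loss loss theta m)%E.
Proof. by apply: integral_ge0 => a _; rewrite lee_fin. Qed.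

Lemma risk_ge0 theta delta : (0 <= risk loss P theta delta)%E.
Proof. by apply: integral_ge0 => x _; exact: expected_loss_ge0. Qed.

Section Combination.
Variables (n : nat) (p : 'I_n -> R) (deltas : 'I_n -> X -> probability A R).
Variable delta : X -> probability A R.
Hypothesis wp : convex_weights p.
Hypothesis D_deltas : forall i, procD loss P (deltas i).
Hypothesis delta_comb : is_combination p deltas delta.

Lemma expected_loss_combination theta x :
  expected_loss loss theta (delta x) =
  (\sum_(i < n) (p i)%:E * expected_loss loss theta (deltas i x))%E.
Proof.
apply: integral_mixture => //; first exact: delta_comb.
  by move=> a; rewrite lee_fin.
exact: measurable_loss.
Qed.

Lemma risk_combination theta :
  risk loss P theta delta = (\sum_(i < n) (p i)%:E * risk loss P theta (deltas i))%E.
Proof.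
have mE i : measurable_fun [set: X] (fun x => expected_loss loss theta (deltas i x)).
  exact: (D_deltas i).1.
rewrite /risk; under eq_integral do rewrite expected_loss_combination.
rewrite ge0_integral_sum//.
- apply: eq_bigr => i _; rewrite ge0_integralZl_EFin//; last exact: wp.1.
  by move=> x _; exact: expected_loss_ge0.
- by move=> i; exact: measurable_funeM.
- move=> i x _; rewrite mule_ge0 ?expected_loss_ge0// lee_fin; exact: wp.1.
Qed.

Lemma procD_combination : procD loss P delta.
Proof.
split=> theta.
  rewrite (_ : (fun x => _) = (fun x =>
      (\sum_(i < n) (p i)%:E * expected_loss loss theta (deltas i x))%E)).
    apply: emeasurable_sum => i; apply: measurable_funeM; exact: (D_deltas i).1.
  by apply/funext => x; exact: expected_loss_combination.
rewrite risk_combination; apply: lte_sum_pinfty => i _.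
by apply: lte_mul_pinfty => //; [rewrite lee_fin; exact: wp.1|exact: (D_deltas i).2].
Qed.

End Combination.

Lemma combination_exists n (p : 'I_n -> R) (deltas : 'I_n -> X -> probability A R) :
  convex_weights p -> exists delta, is_combination p deltas delta.
Proof.
move=> wp; have /choice[delta dE] x := mixture_exists (fun i => deltas i x) wp.
by exists delta => x B _; exact: dE.
Qed.

Lemma procD0_procD : procD0 loss P `<=` procD loss P.
Proof. by move=> delta []. Qed.

Lemma procD0FC_procD : procD0FC loss P `<=` procD loss P.
Proof.
move=> delta [n [p [ds [wp D0 dE]]]].
by apply: (procD_combination wp _ dE) => i; apply: procD0_procD.
Qed.

Lemma procD0_procD0FC : procD0 loss P `<=` procD0FC loss P.
Proof.
move=> delta D0; exists 1%N, (fun=> 1), (fun=> delta); split=> //.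
  by split=> //; rewrite big_ord1.
by move=> x B mB; rewrite big_ord1 mul1e.
Qed.

(** The minimax argument works with real functions; on [procD], where risks are finite, [fine] loses
    nothing. *)
Definition rrisk delta theta : R := fine (risk loss P theta delta).

Lemma rriskE delta theta : procD loss P delta ->
  (rrisk delta theta)%:E = risk loss P theta delta.
Proof. by move=> [_ fin]; rewrite fineK// ge0_fin_numE ?fin// risk_ge0. Qed.

Lemma rrisk_ge0 delta theta : 0 <= rrisk delta theta.
Proof. exact/fine_ge0/risk_ge0. Qed.

Lemma rrisk_continuous delta : procD loss P delta -> continuous (rrisk delta).
Proof.
move=> D theta; apply: fine_cvg; rewrite rriskE//; exact: risk_continuous.
Qed.

Lemma bayes_riskE (pi : prior R Theta) delta : procD loss P delta ->
  bayes_risk loss P pi delta = (\int[pi]_theta (rrisk delta theta)%:E)%E.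
Proof. by move=> D; apply: eq_integral => theta _; rewrite rriskE. Qed.

Lemma sub_extended_admissible C C' delta : C' `<=` C ->
  extended_admissible loss P C delta -> extended_admissible loss P C' delta.
Proof.
by move=> CC adm e e0 [delta' [/CC Cd dom]]; apply: (adm e e0); exists delta'.
Qed.

Lemma sub_eps_bayes C C' (e : R) (pi : prior R Theta) delta : C' `<=` C ->
  eps_bayes loss P e pi C delta -> eps_bayes loss P e pi C' delta.
Proof. by move=> CC [fin h]; split=> // delta' /CC; exact: h. Qed.

Lemma bayes_extended_bayes C delta :
  bayes loss P C delta -> extended_bayes loss P C delta.
Proof.
move=> [pi [fin h]] e e0; exists pi; split=> // delta' /h/le_trans; apply.
by rewrite adde0 leeDl// lee_fin ltW.
Qed.

(** Let I and I' be the Bayes risks of [delta] and of an e-dominating [delta'] under a prior for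
    which [delta] is (e / 2)-Bayes. Integrating the domination gives I' + e <= I <= I' + e / 2,
    impossible as I is finite. *)
Lemma extended_bayes_admissible C delta : C `<=` procD loss P ->
  procD loss P delta ->
  extended_bayes loss P C delta -> extended_admissible loss P C delta.
Proof.
move=> CD D ext e e0 [delta' [C' [dom _]]]; have D' := CD _ C'.
have [|pi [fin /(_ _ C')]] := ext (e / 2); first by rewrite divr_gt0.
move: fin; rewrite !bayes_riskE// => fin.
have mr d : procD loss P d -> measurable_fun
    [set: g_sigma_algebraType (@open Theta)] (fun theta => (rrisk d theta)%:E : \bar R).
  by move=> Dd; apply/measurable_EFinP; exact: continuous_borel (rrisk_continuous Dd).
have : (\int[pi]_theta (rrisk delta' theta)%:E + e%:E <=
        \int[pi]_theta (rrisk delta theta)%:E)%E.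
  have -> : e%:E = (\int[pi]_theta (cst e%:E theta))%E.
    rewrite integral_cst// -[LHS]mule1.
    by congr (_ * _)%E; rewrite [RHS](@probability_setT _ _ _ pi).
  rewrite -ge0_integralD//.
  - apply: ge0_le_integral => //.
    + by move=> theta _; rewrite lee_fin addr_ge0 ?rrisk_ge0// ltW.
    + by apply: emeasurable_funD => //; exact: mr.
    + exact: mr.
    + move=> theta _; have := dom theta; rewrite -!rriskE// -EFinB -EFinD !lee_fin /=.
      by lra.
  - by move=> theta _; rewrite lee_fin rrisk_ge0.
  - exact: mr.
  - by move=> theta _; rewrite lee_fin ltW.
have i0 : (0 <= \int[pi]_theta (rrisk delta' theta)%:E)%E.
  by apply: integral_ge0 => theta _; rewrite lee_fin rrisk_ge0.
have j0 : (0 <= \int[pi]_theta (rrisk delta theta)%:E)%E.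
  by apply: integral_ge0 => theta _; rewrite lee_fin rrisk_ge0.
move: fin i0 j0.
case: (\int[pi]_theta (rrisk delta theta)%:E)%E => [j||]// _.
case: (\int[pi]_theta (rrisk delta' theta)%:E)%E => [i||]// _ _.
by rewrite -!EFinD !lee_fin; lra.
Qed.

(** [minimax_prior] is applied to the risk functions of nonrandomized procedures: a convex
    combination of these lying below the risk of [delta] by e would be the risk of a mixture in
    [procD0FC], against extended admissibility. *)
Lemma extended_admissible_bayes delta : procD loss P delta ->
  extended_admissible loss P (procD0FC loss P) delta ->
  bayes loss P (procD0FC loss P) delta.
Proof.
move=> D adm.
have [|||||pi [fin piK]] := @minimax_prior R Theta
    [set rrisk d | d in procD0 loss P] (rrisk delta) Theta_compact Theta_hausdorff.
- by move=> _ [d /procD0_procD Dd <-]; exact: rrisk_continuous.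
- by move=> _ [d _ <-] theta; exact: rrisk_ge0.
- exact: rrisk_continuous.
- exact: rrisk_ge0.
- move=> n p f e wp Kf e0 dom.
  have /choice[ds dsE] i : exists d, procD0 loss P d /\ rrisk d = f i.
    by have [d Dd dE] := Kf i; exists d.
  have [d dc] := combination_exists ds wp.
  have Dds i : procD loss P (ds i) by apply: procD0_procD; have [] := dsE i.
  have le theta : (risk loss P theta d <= risk loss P theta delta - e%:E)%E.
    rewrite (risk_combination wp Dds dc) -rriskE// -EFinB.
    under eq_bigr do rewrite -rriskE// -EFinM.
    rewrite sumEFin lee_fin; apply: le_trans (dom theta).
    by apply: ler_sum => i _; have [_ ->] := dsE i.
  apply: (adm e e0); exists d; split.
    by exists n, p, ds; split => // i; have [] := dsE i.
  (* Equal risks at [point] would contradict the gap e > 0. *)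
  split=> //; exists point => eqr; have := le point; rewrite eqr -rriskE// -EFinB lee_fin.
  by lra.
exists pi; split; first by rewrite bayes_riskE.
move=> d [n [p [ds [wp D0 dc]]]]; rewrite adde0.
have Dds i : procD loss P (ds i) by exact: procD0_procD.
have mr i : measurable_fun [set: g_sigma_algebraType (@open Theta)]
    (fun theta => (rrisk (ds i) theta)%:E : \bar R).
  by apply/measurable_EFinP; exact: continuous_borel (rrisk_continuous (Dds i)).
rewrite bayes_riskE//.
have -> : bayes_risk loss P pi d =
    (\sum_(i < n) (p i)%:E * \int[pi]_theta (rrisk (ds i) theta)%:E)%E.
  transitivity (\int[pi]_theta (\sum_(i < n) (p i)%:E * (rrisk (ds i) theta)%:E))%E.
    apply: eq_integral => theta _; rewrite (risk_combination wp Dds dc).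
    by apply: eq_bigr => i _; rewrite rriskE.
  rewrite ge0_integral_sum//.
  - apply: eq_bigr => i _; rewrite ge0_integralZl_EFin//; last exact: wp.1.
    by move=> theta _; rewrite lee_fin rrisk_ge0.
  - by move=> i; apply: measurable_funeM; exact: mr.
  - by move=> i theta _; rewrite mule_ge0// lee_fin ?rrisk_ge0//; exact: wp.1.
(* As the weights sum to 1, averaging the comparisons with the components [ds i] gives the
   comparison with the mixture. *)
rewrite -[leLHS]mul1e -wp.2 -sumEFin ge0_sume_distrl; last first.
  by move=> i _; rewrite lee_fin; exact: wp.1.
apply: lee_sum => i _; apply: lee_wpmul2l; first by rewrite lee_fin; exact: wp.1.
by apply: piK; exists (ds i).
Qed.

(** [m] and the Dirac measure at [a] agree on measurable sets: if [a] is outside [B], the complement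
    of [B] has mass 1, so [B] is null. *)
Lemma expected_loss_concentrated theta (m : probability A R) (a : A) :
  concentrated_at m a -> expected_loss loss theta m = (loss theta a)%:E.
Proof.
move=> ma; rewrite /expected_loss (@eq_measure_integral _ _ _ setT (dirac a)).
  by rewrite integral_dirac//= ?diracT ?mul1e//; exact: measurable_loss.
move=> B mB _; rewrite [RHS]diracE; have [aB|aB] := boolP (a \in B).
  exact: ((ma B mB).2 (set_mem aB)).
have [_] := ma _ (measurableC mB); rewrite probability_setC// => h.
have {}h : (1 - m B = 1)%E by apply: h => /mem_set; rewrite (negbTE aB).
suff : m B = 0%E by [].
have := fin_num_measure m B mB; move: h.
by case: (m B) => [r||]//; rewrite -EFinB => -[] h _; congr EFin; lra.
Qed.

(** Jensen's inequality at each [x] bounds the loss at the mean action by the average loss of the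
    components; integrating in [x] compares the risks. *)
Lemma mean_action_dominates (vs : GRing.Lmodule R A) (delta : X -> probability A R) :
  convex_loss loss vs -> mean_action_measurable loss P vs ->
  procD0FC loss P delta ->
  exists2 delta', procD0 loss P delta' &
    forall theta, (risk loss P theta delta' <= risk loss P theta delta)%E.
Proof.
move=> cl mam C; have D := procD0FC_procD C.
have [n [p [ds [wp D0 dc]]]] := C.
have Dds i : procD loss P (ds i) by exact: procD0_procD.
have /choice[d dP] (i : 'I_n) : exists d : X -> A,
    forall x, concentrated_at (ds i x) (d x).
  have /choice[f fP] x : exists a, concentrated_at (ds i x) a by exact: (D0 i).2.
  by exists f.
pose mean x := mean_action vs p (fun i => d i x).
pose delta' x : probability A R := dirac (mean x).
have ca x : concentrated_at (delta' x) (mean x).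
  move=> B mB; rewrite /delta' /= diracE; have [xB|xB] := boolP (mean x \in B).
    by split=> // _; exact: set_mem.
  split=> [/eqP|/mem_set]; last by rewrite (negbTE xB).
  by rewrite eqe eq_sym oner_eq0.
have elE theta x : expected_loss loss theta (delta' x) = (loss theta (mean x))%:E.
  exact: expected_loss_concentrated.
have mel theta : measurable_fun [set: X]
    (fun x => expected_loss loss theta (delta' x)).
  under eq_fun do rewrite elE.
  by apply/measurable_EFinP; apply: mam wp D0 dP theta.
have le theta : (risk loss P theta delta' <= risk loss P theta delta)%E.
  apply: ge0_le_integral => //.
  - by move=> x _; exact: expected_loss_ge0.
  - exact: D.1.
  move=> x _; rewrite elE (expected_loss_combination wp dc).
  rewrite (eq_bigr (fun i => (p i * loss theta (d i x))%:E)) => [|i _].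
    by rewrite sumEFin lee_fin; exact: (convex_function_sum (cl theta)).
  by rewrite (expected_loss_concentrated _ (dP i x)) EFinM.
exists delta' => //; split; last by move=> x; exists (mean x).
by split=> // theta; apply: le_lt_trans (le theta) _; exact: D.2.
Qed.

(** Replacing a dominating mixture by its mean-action procedure keeps the uniform gap e, and this
    gap forces the risks to differ. *)
Lemma extended_admissible_procD0 (vs : GRing.Lmodule R A)
    (delta : X -> probability A R) :
  convex_loss loss vs -> mean_action_measurable loss P vs -> procD loss P delta ->
  extended_admissible loss P (procD0 loss P) delta ->
  extended_admissible loss P (procD0FC loss P) delta.
Proof.
move=> cl mam D adm e e0 [d [C [dom _]]].
have [d' D0 le] := mean_action_dominates cl mam C.
have dom' theta : (risk loss P theta d' <= risk loss P theta delta - e%:E)%E.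
  exact: le_trans (le theta) (dom theta).
apply: (adm e e0); exists d'; split=> //; split=> //; exists point => eqr.
by have := dom' point; rewrite eqr -rriskE// -EFinB lee_fin; lra.
Qed.

End Decision.

(** * The equivalences *)

Unset Implicit Arguments.
Set Strict Implicit.
Theorem theorem6p11 (R : realType) (dX dA : measure_display)
    (X : measurableType dX) (A : measurableType dA) (Theta : ptopologicalType)
    (loss : Theta -> A -> R) (P : Theta -> probability X R)
    (loss_ge0 : forall theta a, 0 <= loss theta a)
    (loss_meas : forall theta, measurable_fun [set: A] (loss theta))
    (Theta_compact : compact [set: Theta])
    (Theta_hausdorff : hausdorff_space Theta)
    (risk_continuous : forall delta, procD loss P delta ->
      continuous (fun theta => risk loss P theta delta))
    (delta0 : X -> probability A R) (delta0_D : procD loss P delta0) :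
  [<-> extended_admissible loss P (procD0FC loss P) delta0;
       extended_bayes loss P (procD0FC loss P) delta0;
       bayes loss P (procD0FC loss P) delta0] /\
  (forall vs : GRing.Lmodule R A,
    convex_loss loss vs -> mean_action_measurable loss P vs ->
    [<-> extended_admissible loss P (procD0FC loss P) delta0;
         extended_bayes loss P (procD0FC loss P) delta0;
         bayes loss P (procD0FC loss P) delta0;
         extended_admissible loss P (procD0 loss P) delta0;
         extended_bayes loss P (procD0 loss P) delta0;
         bayes loss P (procD0 loss P) delta0]).
Proof.
have FC : [<-> extended_admissible loss P (procD0FC loss P) delta0;
       extended_bayes loss P (procD0FC loss P) delta0;
       bayes loss P (procD0FC loss P) delta0].
  have a_b := @extended_admissible_bayes _ _ _ _ _ _ loss P loss_ge0 loss_meas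
    Theta_compact Theta_hausdorff risk_continuous delta0 delta0_D.
  have b_e := @bayes_extended_bayes _ _ _ _ _ _ loss P (procD0FC loss P) delta0.
  have e_a := @extended_bayes_admissible _ _ _ _ _ _ loss P loss_ge0
    risk_continuous _ delta0 (procD0FC_procD loss_ge0 loss_meas) delta0_D.
  (* The arrows available run from extended admissible to Bayes to extended Bayes and back; each
     listed implication composes two of them. *)
  by tfae => [/a_b/b_e|/e_a/a_b|/b_e/e_a].
split=> // vs cl mam.
have sub := @procD0_procD0FC _ _ _ _ _ _ loss P.
have lift := @extended_admissible_procD0 _ _ _ _ _ _ loss P loss_ge0 loss_meas
  vs delta0 cl mam delta0_D.
have e_a := @extended_bayes_admissible _ _ _ _ _ _ loss P loss_ge0
  risk_continuous _ delta0 (@procD0_procD _ _ _ _ _ _ loss P) delta0_D.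
have b_e := @bayes_extended_bayes _ _ _ _ _ _ loss P (procD0 loss P) delta0.
(* Bayes properties pass from [procD0FC] to [procD0] by shrinking the class. The way back, [lift],
   concerns extended admissibility, so each statement about [procD0] is first brought to that
   form. *)
tfae.
- exact: (FC 0%N 1%N).1.
- exact: (FC 1%N 2%N).1.
- move=> /(FC 2%N 0%N); exact: sub_extended_admissible.
- move=> /lift/(FC 0%N 1%N) h e /h[pi bpi]; exists pi; exact: sub_eps_bayes bpi.
- move=> /e_a/lift/(FC 0%N 2%N)[pi bpi]; exists pi; exact: sub_eps_bayes bpi.
- by move=> /b_e/e_a/lift.
Qed.
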